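(* In the setting of the context, assume $S$ is infinite. Then for all sufficiently large integers $K$ such that $p_K:=u+Kv\in S$, the number $f(K)$ is not $p_K$-integral while $p_Kf(K)$ is $p_K$-integral.
   Context: $q=e^{2\pi i\tau}$, $q^s=e^{2\pi is\tau}$, $\Gamma_0(2)=\{\gamma\in\mathrm{SL}_2(\mathbf{Z}):\gamma_{21}\equiv0\bmod2\}$, $T=\begin{pmatrix}1&1\\0&1\end{pmatrix}$. $E_2=1-24\sum\sigma(n)q^n$, $E_4=1+240\sum\sigma_3(n)q^n$, $G(\tau)=-E_2(\tau)+2E_2(2\tau)$, $D_kA=\frac{1}{2\pi i}A'-\frac{k}{12}E_2A$. Setting: $\rho:\Gamma_0(2)\to\mathrm{GL}_2(\mathbf{C})$ irreducible; $k_0$ least with $M_{k_0}(\rho)\ne0$ (holomorphic weight-$k_0$ vector-valued modular forms for $\rho$), $F\ne0$ in it; $a,b,c$ unique with $D_{k_0+2}D_{k_0}F+aGD_{k_0}F+(bG^2+cE_4)F=0$; $r$ a root of $r^2-(a+\frac13)r+b+4c=0$. Standing assumption: $\rho(T)$ has finite order, $c\in\mathbf{Q}$, $[\mathbf{Q}(r):\mathbf{Q}]=2$. Fix $X$ with $X\rho(T)X^{-1}=\mathrm{diag}(e^{2\pi im_1},e^{2\pi im_2})$ ($|m_1|\le|m_2|$); components of $XF$ are $\lambda_iq^{k_0/12+l_i}(1+O(q))$ with $\lambda_i\neq0$; $A=r+l_1$, $B=r+l_2$; then $A-B\in\mathbf{Q}\setminus\mathbf{Z}$; write $A-B=u/v$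 with $u,v\in\mathbf{Z}$, $v>1$, $\gcd(u,v)=1$. $M$ is the square-free integer with $\mathbf{Q}(r)=\mathbf{Q}(\sqrt M)$; $S$ is the set of odd primes $p$ with $M$ a non-residue mod $p$ and $p\equiv u\pmod v$. With $\binom{x}{n}=x(x-1)\cdots(x-n+1)/n!$ and $(x)_n=\prod_{i<n}(x+i)$: $g(m,n)=\binom{r}{n}\frac{(-1)^n2^{4m+6n}(2A)_{2m}}{(1+A-B)_mm!}$, $f(k)=\sum_{m,n\ge0,\,m+n=k}g(m,n)$. An algebraic number $\zeta$ is $p$-integral if $p$ does not divide its denominator (the least positive integer $N$ with $N\zeta$ an algebraic integer). *)

(* Defs.v *)
From HB Require Import structures.
From mathcomp Require Import all_boot all_order all_algebra.
From mathcomp Require Import all_classical all_reals all_analysis.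
From mathcomp Require Export complex.

Set Implicit Arguments.
Unset Strict Implicit.
Unset Printing Implicit Defensive.

Import Order.TTheory GRing.Theory Num.Theory.
Import numFieldNormedType.Exports.

Local Open Scope classical_set_scope.
Local Open Scope ring_scope.

(* R[i], packaged so that the topology carried by every numFieldType applies;
   [derivable] and [^`()] over this field are complex differentiability and
   the complex derivative. *)
Definition Cplx (R : realType) : numClosedFieldType := R[i].

Section Analysis.
Variable R : realType.
Local Notation C := (Cplx R).

Definition reC (z : C) : R := complex.Re z.
Definition imC (z : C) : R := complex.Im z.
Definition ofR (x : R) : C := Complex x 0.

Definition cexp (z : C) : C :=
  Complex (expR (reC z) * cos (imC z)) (expR (reC z) * sin (imC z)).

Definition twopii : C := Complex 0 (2 * pi).

Definition e2pi (z : C) : C := cexp (twopii * z).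

Definition upper : set C := [set tau | 0 < imC tau].

(* q^s *)
Definition qpow (s tau : C) : C := e2pi (s * tau).
Definition q (tau : C) : C := qpow 1 tau.

Definition sigma (k n : nat) : nat := (\sum_(d <- divisors n) d ^ k)%N.

Definition qseries (a : nat -> C) (tau : C) : C :=
  limn (series (fun n => a n * q tau ^+ n)).

Definition E2 (tau : C) : C :=
  1 - 24 * qseries (fun n => if n == 0%N then 0 else (sigma 1 n)%:R) tau.

Definition E4 (tau : C) : C :=
  1 + 240 * qseries (fun n => if n == 0%N then 0 else (sigma 3 n)%:R) tau.

Definition G (tau : C) : C := - E2 tau + 2 * E2 (2 * tau).

Definition Dk (k : int) (f : C -> C) (tau : C) : C :=
  twopii^-1 * (f^`())%classic tau - k%:~R / 12 * E2 tau * f tau.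

Definition SL2Z : set 'M[int]_2 := [set g | \det g = 1].
Definition Gamma02 : set 'M[int]_2 := [set g | SL2Z g /\ (2 %| (g 1 0)%R)%Z].
Definition Tmx : 'M[int]_2 := \matrix_(i, j) (if (i == 1) && (j == 0) then 0 else 1).

Definition autj (g : 'M[int]_2) (tau : C) : C :=
  (g 1 0)%:~R * tau + (g 1 1)%:~R.

Definition moebius (g : 'M[int]_2) (tau : C) : C :=
  ((g 0 0)%:~R * tau + (g 0 1)%:~R) / autj g tau.

Definition slash (k : int) (g : 'M[int]_2) (F : C -> 'cV[C]_2) (tau : C)
    : 'cV[C]_2 :=
  autj g tau ^ (- k) *: F (moebius g tau).

(* Only the values of rho on Gamma02 are relevant. *)
Definition is_representation (rho : 'M[int]_2 -> 'M[C]_2) : Prop :=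
  (forall g, Gamma02 g -> rho g \in unitmx) /\
  (forall g h, Gamma02 g -> Gamma02 h -> rho (g *m h) = rho g *m rho h).

Definition irreducible_rep (rho : 'M[int]_2 -> 'M[C]_2) : Prop :=
  forall U : {vspace 'cV[C]_2},
    (forall g v, Gamma02 g -> v \in U -> rho g *m v \in U) ->
    U = 0%VS \/ U = fullv.

Definition coord_fun (F : C -> 'cV[C]_2) (i : 'I_2) : C -> C :=
  fun tau => F tau i 0.

Definition holomorphic_on_upper (F : C -> 'cV[C]_2) : Prop :=
  forall i tau, upper tau -> derivable (coord_fun F i : C^o -> C^o) tau 1.

(* Moderate growth of F at i * oo in every vertical strip.  For forms that are
   equivariant under a translation matrix with eigenvalues e(mu), 0 <= Re mu < 1,
   this says that the (possibly logarithmic) expansion only involves the terms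
   q^(mu + n) with n >= 0. *)
Definition moderate_growth (F : C -> 'cV[C]_2) : Prop :=
  forall x0 : R, exists (N : nat) (y0 : R), forall i tau,
    upper tau -> `|reC tau| <= x0 -> y0 <= imC tau ->
    `|F tau i 0| <= ofR (imC tau ^+ N).

(* M_k(rho); F |_k g, for g running over SL2(Z), reaches all cusps. *)
Definition is_vvmf (k : int) (rho : 'M[int]_2 -> 'M[C]_2)
    (F : C -> 'cV[C]_2) : Prop :=
  [/\ holomorphic_on_upper F,
      forall g tau, Gamma02 g -> upper tau -> slash k g F tau = rho g *m F tau
    & forall g, SL2Z g -> moderate_growth (slash k g F)].

(* Forms are functions on the upper half plane: values elsewhere are junk. *)
Definition is_zero_form (F : C -> 'cV[C]_2) : Prop :=
  forall tau, upper tau -> F tau = 0.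

Definition is_minimal_weight (rho : 'M[int]_2 -> 'M[C]_2) (k0 : int) : Prop :=
  (exists F, is_vvmf k0 rho F /\ ~ is_zero_form F) /\
  (forall k F, is_vvmf k rho F -> ~ is_zero_form F -> k0 <= k).

Definition satisfies_mlde (k0 : int) (a b c : C) (F : C -> 'cV[C]_2) : Prop :=
  forall i tau, upper tau ->
    let f := coord_fun F i in
    Dk (k0 + 2) (Dk k0 f) tau + a * G tau * Dk k0 f tau
      + (b * G tau ^+ 2 + c * E4 tau) * f tau = 0.

(* f = lam * q^s * (1 + O(q)), where 1 + O(q) stands for a power series in q
   with constant term 1 *)
Definition has_leading_term (f : C -> C) (lam s : C) : Prop :=
  exists a : nat -> C, a 0%N = 1 /\
    forall tau, upper tau ->
      exists w : C, (series (fun n => a n * q tau ^+ n) @ \oo --> w) /\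
        f tau = lam * qpow s tau * w.

Definition finite_order (X : 'M[C]_2) : Prop :=
  exists n, (0 < n)%N /\ X ^+ n = 1.

Definition diag2 (x y : C) : 'M[C]_2 :=
  \matrix_(i, j) (if i == j then (if i == 0 then x else y) else 0).

Definition is_rational (z : C) : Prop := exists s : rat, z = ratr s.

(* The subfield Q(x) of the complex numbers. *)
Definition Qadj (x : C) : set C :=
  [set z | exists f g : {poly rat}, (map_poly ratr g).[x] != 0 /\
     z = (map_poly ratr f).[x] / (map_poly ratr g).[x]].

(* [Q(x) : Q] = d *)
Definition Qdegree (x : C) (d : nat) : Prop :=
  exists b : 'I_d -> C, (forall i, Qadj x (b i)) /\
    forall z, Qadj x z ->
      exists! s : {ffun 'I_d -> rat}, z = \sum_i ratr (s i) * b i.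

Definition binomC (x : C) (n : nat) : C := (\prod_(i < n) (x - i%:R)) / n`!%:R.

Definition poch (x : C) (n : nat) : C := \prod_(i < n) (x + i%:R).

Definition gcoef (r A B : C) (m n : nat) : C :=
  binomC r n * ((-1) ^+ n * 2 ^+ (4 * m + 6 * n) * poch (2 * A) (2 * m))
    / (poch (1 + A - B) m * m`!%:R).

Definition fcoef (r A B : C) (k : nat) : C :=
  \sum_(m < k.+1) gcoef r A B m (k - m).

Definition algebraic_integer (z : C) : Prop :=
  integralOver (intr : int -> C) z.

Definition is_denominator (z : C) (N : nat) : Prop :=
  [/\ (0 < N)%N, algebraic_integer (N%:R * z)
    & forall N', (0 < N')%N -> algebraic_integer (N'%:R * z) -> (N <= N')%N].

Definition p_integral (p : nat) (z : C) : Prop :=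
  exists N, is_denominator z N /\ ~~ (p %| N)%N.

End Analysis.

Definition squarefree (M : int) : Prop :=
  forall d : int, (d ^+ 2 %| M)%Z -> `|d| = 1.

Definition primeS (M u v : int) : set nat :=
  [set p | [/\ prime p, odd p,
               forall x : int, ~~ (p%:Z %| x ^+ 2 - M)%Z
             & (p%:Z = u %[mod v])%Z]].

(* Main.v *)
(** Since [rho T] has finite order and the first component of [X F] does not
    vanish identically, [e^(2 pi i (k0/12 + l1))] is a root of unity, so [l1] is
    rational and [A = r + l1] lies in [Q(sqrt M)] with an irrational part
    independent of the index.  Put [p = u + K v].  As [1 + A - B + i] is
    [(u + (i + 1) v) / v], the prime [p] divides [(1 + A - B)_m] only for
    [m = K], and then exactly once, so [g(K, 0)] is the only summand of [f(K)]
    that may fail to be [p]-integral, and its denominator contains [p] at most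
    once.  It does contain it: the norm of each factor [2A + i] of the numerator
    is, up to units at [p], of the form [U^2 - M V^2] with [V] prime to [p], and
    [p] does not divide such a number because [M] is a non-residue modulo [p]. *)
Require Import Defs.
From mathcomp Require Import all_boot all_order all_algebra.
From mathcomp Require Import all_classical all_reals all_analysis.
From mathcomp Require Import ring lra zify.

Import Order.TTheory GRing.Theory Num.Theory.
Import numFieldNormedType.Exports.
Local Open Scope classical_set_scope.
Local Open Scope ring_scope.

(** * Algebraic integers, and their divisibility by a rational prime *)

Lemma algintD (R : realType) (x y : Cplx R) :
  algebraic_integer x -> algebraic_integer y -> algebraic_integer (x + y).
Proof. exact: (@integral_add int (Cplx R) intr). Qed.

Lemma algintM (R : realType) (x y : Cplx R) :
  algebraic_integer x -> algebraic_integer y -> algebraic_integer (x * y).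
Proof. exact: (@integral_mul int (Cplx R) intr). Qed.

Lemma algint_int (R : realType) (n : int) :
  algebraic_integer (n%:~R : Cplx R).
Proof. exact: (@integral_id int (Cplx R) intr). Qed.

Lemma algint_nat (R : realType) (n : nat) : algebraic_integer (n%:R : Cplx R).
Proof. exact: (@integral_nat int (Cplx R) intr). Qed.

Lemma algint_sqrt (R : realType) (s : Cplx R) (M : int) :
  s ^+ 2 = M%:~R -> algebraic_integer s.
Proof.
move=> sE; exists ('X^2 - M%:P).
  by apply: monicXnsubC.
by rewrite rmorphB /= map_polyXn map_polyC /= rootE !hornerE sE subrr.
Qed.

(* Clearing denominators in a monic equation of degree d gives p | m ^ d. *)
Lemma dvdz_algint (R : realType) (p : nat) (m : int) (w : Cplx R) :
  prime p -> algebraic_integer w -> m%:~R = p%:R * w -> (p%:Z %| m)%Z.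
Proof.
move=> pp [P Pm Pw] mE.
have sP : (0 < size P)%N by rewrite size_poly_gt0 monic_neq0.
pose d := (size P).-1.
have sPE : size P = d.+1 by rewrite prednK.
have e : \sum_(i < d.+1) P`_i * m ^+ i * p%:Z ^+ (d - i) = 0 :> int.
  apply: (@intr_inj (Cplx R)); rewrite rmorph_sum /=.
  transitivity (p%:R ^+ d * (map_poly intr P).[w] : Cplx R); last first.
    by move/eqP: Pw => ->; rewrite mulr0.
  rewrite horner_coef size_map_inj_poly //; last exact: intr_inj.
  rewrite sPE mulr_sumr; apply: eq_bigr => i _.
  rewrite coef_map /= !rmorphM !rmorphXn /= mE exprMn.
  have -> : p%:R ^+ d = p%:R ^+ i * p%:R ^+ (d - i) :> Cplx R.
    by rewrite -exprD subnKC // -ltnS.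
  ring.
move: e; rewrite big_ord_recr /= subnn expr0 mulr1.
have -> : P`_d = 1 by move/monicP: Pm; rewrite lead_coefE.
rewrite mul1r addrC => /eqP; rewrite addr_eq0 => /eqP me.
have : (p%:Z %| m ^+ d)%Z.
  rewrite me rpredN; apply: rpred_sum => i _; apply: dvdz_mull.
  by have := ltn_ord i; rewrite -subn_gt0 => /prednK <-; rewrite exprS dvdz_mulr.
by rewrite !dvdzE /= abszX Euclid_dvdX // => /andP[].
Qed.

(** * Integrality at [p], with any multiplier prime to [p] in place of the least one *)

Definition pint {R : realType} (p : nat) (z : Cplx R) : Prop :=
  exists2 N : nat, ~~ (p %| N)%N & algebraic_integer (N%:R * z).

(* The denominator of [z] divides every [N] such that [N z] is integral. *)
Lemma p_integralP (R : realType) (p : nat) (z : Cplx R) :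
  p_integral p z <-> pint p z.
Proof.
split=> [[N [[_ Nz _] pN]]|[N pN Nz]]; first by exists N.
have N0 : (0 < N)%N by case: N pN {Nz} => //; rewrite dvdn0.
pose P k := (0 < k)%N && `[< algebraic_integer (k%:R * z) >].
have exP : exists k, P k by exists N; rewrite /P N0; apply/asboolP.
case: (ex_minnP exP) => n /andP[n0 /asboolP nz] nmin.
exists n; split.
  by split=> // k k0 kz; apply: nmin; rewrite /P k0; apply/asboolP.
apply: contra pN => /dvdn_trans; apply.
(* A nonzero remainder of [N] modulo [n] would be a smaller multiplier, as multipliers are closed
   under integer combinations. *)
rewrite /dvdn -[_ == _]negbK -lt0n; apply/negP => r0.
suff : (n <= N %% n)%N by rewrite leqNgt ltn_mod n0.
apply: nmin; rewrite /P r0; apply/asboolP.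
have -> : (N %% n)%N%:R * z = N%:R * z + (- (N %/ n)%:Z)%:~R * (n%:R * z).
  rewrite {2}(divn_eq N n) natrD natrM rmorphN /=; ring.
by apply: algintD => //; apply: algintM => //; apply: algint_int.
Qed.

Lemma pintD (R : realType) (p : nat) (x y : Cplx R) :
  prime p -> pint p x -> pint p y -> pint p (x + y).
Proof.
move=> pp [n pn nx] [m pm my]; exists (n * m)%N.
  by rewrite Euclid_dvdM // negb_or pn.
have -> : (n * m)%:R * (x + y) = m%:R * (n%:R * x) + n%:R * (m%:R * y).
  by rewrite natrM; ring.
by apply: algintD; apply: algintM => //; apply: algint_nat.
Qed.

Lemma pintM (R : realType) (p : nat) (x y : Cplx R) :
  prime p -> pint p x -> pint p y -> pint p (x * y).
Proof.
move=> pp [n pn nx] [m pm my]; exists (n * m)%N.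
  by rewrite Euclid_dvdM // negb_or pn.
have -> : (n * m)%:R * (x * y) = (n%:R * x) * (m%:R * y).
  by rewrite natrM; ring.
exact: algintM.
Qed.

Lemma pint_algint (R : realType) (p : nat) (x : Cplx R) :
  prime p -> algebraic_integer x -> pint p x.
Proof.
by move=> pp xi; exists 1%N; rewrite ?mul1r // dvdn1; case: p pp => [|[]].
Qed.

Lemma pint_int (R : realType) (p : nat) (n : int) :
  prime p -> pint p (n%:~R : Cplx R).
Proof. by move=> pp; apply: pint_algint => //; apply: algint_int. Qed.

Lemma pint_nat (R : realType) (p : nat) (n : nat) :
  prime p -> pint p (n%:R : Cplx R).
Proof. by move=> pp; apply: pint_algint => //; apply: algint_nat. Qed.

Lemma pint_invz (R : realType) (p : nat) (n : int) :
  prime p -> ~~ (p%:Z %| n)%Z -> pint p ((n%:~R)^-1 : Cplx R).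
Proof.
move=> pp pn.
have n0 : n != 0 by apply: contraNneq pn => ->; rewrite dvdz0.
exists `|n|%N; first by move: pn; rewrite dvdzE.
rewrite pmulrn.
have nC : (n%:~R : Cplx R) != 0 by rewrite intr_eq0.
have [->|->] : `|n|%N%:Z = n \/ `|n|%N%:Z = - n by lia.
  by rewrite mulfV //; exact: (algint_nat _ 1).
by rewrite mulrNz mulNr mulfV //; exact: (algint_int _ (-1)).
Qed.

Lemma pint_invn (R : realType) (p : nat) (n : nat) :
  prime p -> ~~ (p %| n)%N -> pint p ((n%:R)^-1 : Cplx R).
Proof. by move=> pp pn; apply: (@pint_invz R p n%:Z). Qed.

Lemma pint_sum (R : realType) (p n : nat) (f : 'I_n -> Cplx R) :
  prime p -> (forall i, pint p (f i)) -> pint p (\sum_i f i).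
Proof.
move=> pp fi; apply: (big_ind (pint p)) => // [|x y]; last exact: pintD.
exact: (pint_nat R p 0 pp).
Qed.

Lemma pint_prod (R : realType) (p n : nat) (f : 'I_n -> Cplx R) :
  prime p -> (forall i, pint p (f i)) -> pint p (\prod_i f i).
Proof.
move=> pp fi; apply: (big_ind (pint p)) => // [|x y]; last exact: pintM.
exact: (pint_nat R p 1 pp).
Qed.

Lemma pint_exp (R : realType) (p n : nat) (x : Cplx R) :
  prime p -> pint p x -> pint p (x ^+ n).
Proof. by move=> pp xi; rewrite -[n]card_ord -prodr_const; apply: pint_prod. Qed.

(** A multiplier of [z] prime to [p] reduces this to algebraic integers; Euclid's lemma then removes
    the multiplier. *)
Lemma dvdz_pint (R : realType) (p : nat) (n : int) (z : Cplx R) :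
  prime p -> pint p z -> n%:~R = p%:R * z -> (p%:Z %| n)%Z.
Proof.
move=> pp [N pN Nz] nE.
have : (p%:Z %| N%:Z * n)%Z.
  apply: (dvdz_algint _ _ _ _ pp Nz); rewrite rmorphM /= nE -pmulrn; ring.
by rewrite !dvdzE abszM Euclid_dvdM // (negPf pN).
Qed.

(** * Units at [p], and the pole of [f(K)] *)

Lemma fact_pndvd (p n : nat) : prime p -> (n < p)%N -> ~~ (p %| n`!)%N.
Proof.
move=> pp; elim: n => [_|n IH np]; first by rewrite fact0 dvdn1; case: p pp => [|[]].
by rewrite factS Euclid_dvdM // negb_or IH ?(ltnW np) // andbT gtnNdvd.
Qed.

(** Otherwise an inverse [b] of [V] modulo [p] would make [b * U] a square root of [M] modulo
    [p]. *)
Lemma norm_pndvd (p : nat) (M U V : int) :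
  prime p -> (forall x : int, ~~ (p%:Z %| x ^+ 2 - M)%Z) ->
  ~~ (p%:Z %| V)%Z -> ~~ (p%:Z %| U ^+ 2 - M * V ^+ 2)%Z.
Proof.
move=> pp nr pV; apply/negP => /dvdzP[k kE].
have : coprimez p%:Z V by rewrite coprimezE prime_coprime // -dvdzE.
case/coprimezP => -[a b] /= ab.
move: (nr (b * U)); apply/negP; rewrite negbK.
have bV : b * V = 1 - a * p%:Z by rewrite -ab; ring.
(* The second summand comes from [(b V)^2 - 1 = (1 - a p)^2 - 1 = p (-2 a + a^2 p)]. *)
apply/dvdzP; exists (b ^+ 2 * k + M * (- 2 * a + a ^+ 2 * p%:Z)).
have -> : (b * U) ^+ 2 - M = b ^+ 2 * (U ^+ 2 - M * V ^+ 2) + M * ((b * V) ^+ 2 - 1)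
  by ring.
rewrite kE bV; ring.
Qed.

Lemma prod_pndvd (p n : nat) (f : 'I_n -> int) :
  prime p -> (forall i, ~~ (p%:Z %| f i)%Z) -> ~~ (p%:Z %| \prod_i f i)%Z.
Proof.
move=> pp fi; apply: (big_ind (fun x => ~~ (p%:Z %| x)%Z)) => // [|x y].
  by rewrite dvdzE dvdn1; case: p pp {fi} => [|[]].
by rewrite !dvdzE abszM Euclid_dvdM // negb_or => -> ->.
Qed.

Lemma quadratic_pint (R : realType) (z s : Cplx R) (M X Y : int) (D p : nat) :
  s ^+ 2 = M%:~R -> D%:R * z = X%:~R + Y%:~R * s -> ~~ (p %| D)%N -> pint p z.
Proof.
move=> sM zE pD; exists D => //; rewrite zE.
by apply: algintD; last (apply: algintM; last exact: algint_sqrt sM); apply: algint_int.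
Qed.

(* The norms of the factors [2A + i] are prime to [p], as [M] is not a square
   modulo [p]. *)
Lemma poch_pndvd (R : realType) (A s : Cplx R) (M X Y : int) (D n p : nat)
    (z : Cplx R) :
  s ^+ 2 = M%:~R -> D%:R * A = X%:~R + Y%:~R * s -> prime p -> odd p ->
  (forall x : int, ~~ (p%:Z %| x ^+ 2 - M)%Z) ->
  ~~ (p%:Z %| Y)%Z -> pint p z -> poch (2 * A) n <> p%:R * z.
Proof.
move=> sM AE pp podd nr pY zi pochE.
pose U (i : 'I_n) : int := 2 * X + i%:Z * D%:Z.
pose V : int := 2 * Y.
have pV : ~~ (p%:Z %| V)%Z.
  rewrite /V dvdzE abszM Euclid_dvdM // negb_or -!dvdzE pY andbT.
  by rewrite dvdzE /= dvdn_prime2 //; apply: contraTneq podd => ->.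
have si : algebraic_integer s := algint_sqrt _ _ _ sM.
(* Since [D (2A + i) = U i + V s], the [i]-th factor of [w] is [D] times its conjugate. Multiplying
   [(2A)_n] by [w] therefore gives the product of the integer norms [U i ^ 2 - M V ^ 2]. *)
pose w : Cplx R := \prod_(i < n) (D%:R * ((U i)%:~R - V%:~R * s)).
have wi : pint p w.
  apply: pint_prod => // i; apply: pintM => //; first exact: pint_nat.
  apply: pint_algint => //.
  have -> : (U i)%:~R - V%:~R * s = (U i)%:~R + (- V)%:~R * s by rewrite mulrNz mulNr.
  by apply: algintD; last (apply: algintM; last exact: si); apply: algint_int.
have : (p%:Z %| \prod_(i < n) (U i ^+ 2 - M * V ^+ 2))%Z.
  apply: (dvdz_pint R p _ (z * w)) => //; first exact: pintM.
  rewrite mulrA -pochE /poch /w rmorph_prod -big_split /=; apply: eq_bigr => i _.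
  rewrite [RHS]mulrCA [RHS]mulrA.
  have -> : D%:R * (2 * A + i%:R) = (U i)%:~R + V%:~R * s.
    by rewrite mulrDr mulrCA AE /U /V rmorphD !rmorphM /=; ring.
  by rewrite !expr2 rmorphB !rmorphM /= -sM; ring.
by apply/negP/prod_pndvd => // i; apply: norm_pndvd.
Qed.

(** In the application [A - r] is rational, which is why [r] and [A] share the coefficient [Y] and
    differ only in [X] and [X']. *)
Lemma fcoef_pole (R : realType) (r A B s : Cplx R) (M X X' Y u v : int)
    (D K p : nat) :
  s ^+ 2 = M%:~R -> D%:R * r = X%:~R + Y%:~R * s ->
  D%:R * A = X'%:~R + Y%:~R * s -> A - B = u%:~R / v%:~R ->
  prime p -> odd p -> (forall x : int, ~~ (p%:Z %| x ^+ 2 - M)%Z) ->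
  ~~ (p %| D)%N -> ~~ (p%:Z %| Y)%Z -> ~~ (p%:Z %| v)%Z ->
  (0 < K < p)%N -> p%:Z = u + K%:Z * v ->
  ~ pint p (fcoef r A B K) /\ pint p (p%:R * fcoef r A B K).
Proof.
move=> sM rE AE ABE pp podd nr pD pY pv /andP[K0 Kp] pE.
have ri : pint p r by apply: quadratic_pint sM rE pD.
have Ai : pint p A by apply: quadratic_pint sM AE pD.
have p2 : ~~ (p %| 2)%N by rewrite dvdn_prime2 //; apply: contraTneq podd => ->.
have v0 : (v%:~R : Cplx R) != 0.
  by rewrite intr_eq0; apply: contraNneq pv => ->; rewrite dvdz0.
have pC : (p%:R : Cplx R) != 0 by rewrite pnatr_eq0 -lt0n prime_gt0.
(* Numerator of the [i]-th factor of [(1 + A - B)_m]. The leading 1 shifts the index, so [W K.-1] is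
   [p] itself. *)
pose W (i : nat) : int := u + i.+1%:Z * v.
have fE i : 1 + A - B + i%:R = (W i)%:~R / v%:~R.
  rewrite -[1 + A - B]addrA ABE /W rmorphD rmorphM /= -pmulrn -natr1; field.
  exact: v0.
(* Subtracting [W i] from [p = u + K v] leaves [(K - i - 1) v], whose first factor lies strictly
   between 0 and [p]. *)
have Wp i : (i.+1 < K)%N -> ~~ (p%:Z %| W i)%Z.
  move=> iK; apply/negP => pW.
  have : (p%:Z %| (K - i.+1)%N%:Z * v)%Z.
    have -> : (K - i.+1)%N%:Z * v = p%:Z - W i by rewrite /W pE -subzn ?(ltnW iK) //; ring.
    by rewrite rpredB // dvdzz.
  rewrite dvdzE abszM Euclid_dvdM // -!dvdzE (negPf pv) orbF dvdzE /=.
  by rewrite gtnNdvd ?subn_gt0 // (leq_ltn_trans (leq_subr _ _) Kp).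
have pochi m : pint p (poch (1 + A - B) m).
  apply: pint_prod => // i; rewrite fE.
  by apply: pintM => //; [apply: pint_int | apply: pint_invz].
have pochV m : (m < K)%N -> pint p (poch (1 + A - B) m)^-1.
  move=> mK; rewrite -prodfV; apply: pint_prod => // i; rewrite fE invf_div.
  apply: pintM => //; [exact: pint_int | apply: pint_invz => //; apply: Wp].
  exact: leq_ltn_trans (ltn_ord i) mK.
have factV n : (n <= K)%N -> pint p (n`!%:R : Cplx R)^-1.
  by move=> nK; apply: pint_invn => //; apply: fact_pndvd => //; apply: leq_ltn_trans nK Kp.
have poch2i m : pint p (poch (2 * A) m).
  apply: pint_prod => // i; apply: pintD => //; last exact: pint_nat.
  by apply: pintM => //; apply: pint_nat.
have binomi n : (n <= K)%N -> pint p (binomC r n).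
  move=> nK; apply: pintM => //; last exact: factV.
  apply: pint_prod => // i; apply: pintD => //.
  have -> : - i%:R = (- i%:Z)%:~R :> Cplx R by rewrite mulrNz.
  exact: pint_int.
have gi m : (m < K)%N -> pint p (gcoef r A B m (K - m)).
  move=> mK; rewrite /gcoef invfM.
  apply: pintM => //; last first.
    by apply: pintM => //; [exact: pochV | exact/factV/ltnW].
  apply: pintM => //; first exact/binomi/leq_subr.
  apply: pintM => //; apply: pintM => //; apply: pint_exp => //.
    exact: (pint_int _ _ (-1)).
  exact: pint_nat.
(* The last factor, of index [K - 1], is exactly [p / v]; this isolates the only [p] in a
   denominator. *)
have pochK : poch (1 + A - B) K = poch (1 + A - B) K.-1 * (p%:R / v%:~R).
  rewrite -{1}(prednK K0) /poch big_ord_recr /= fE /W prednK // -pE.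
  by rewrite -pmulrn.
have pK1 : poch (1 + A - B) K.-1 != 0.
  apply/prodf_neq0 => i _; rewrite fE mulf_neq0 ?invr_eq0 // intr_eq0.
  have iK : (i.+1 < K)%N by have := ltn_ord i; rewrite -ltnS prednK.
  by apply: contraNneq (Wp i iK) => ->; rewrite dvdz0.
have fK0 : (K`!%:R : Cplx R) != 0 by rewrite pnatr_eq0 -lt0n fact_gt0.
pose g0 := gcoef r A B K 0.
have g0E : g0 = 2 ^+ (4 * K) * poch (2 * A) (2 * K)
                 / (poch (1 + A - B) K.-1 * (p%:R / v%:~R) * K`!%:R).
  by rewrite /g0 /gcoef pochK muln0 addn0 expr0 /binomC big_ord0 fact0 divr1 !mul1r.
pose h := \sum_(m < K) gcoef r A B m (K - m).
have hi : pint p h by apply: pint_sum => // i; apply: gi.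
have fKE : fcoef r A B K = h + g0 by rewrite /fcoef big_ord_recr /= subnn.
have pfi x : pint p x -> pint p (p%:R * x).
  by move=> xi; apply: pintM => //; apply: pint_nat.
split; last first.
  rewrite fKE mulrDr; apply: pintD => //; first exact: pfi.
  have -> : p%:R * g0 = 2 ^+ (4 * K) * poch (2 * A) (2 * K)
       * ((poch (1 + A - B) K.-1)^-1 * v%:~R * (K`!%:R)^-1).
    by rewrite g0E; field; rewrite pC v0 pK1 fK0.
  do ![apply: pintM => //].
  - by apply: pint_exp => //; apply: pint_nat.
  - by apply: pochV; rewrite prednK.
  - exact: pint_int.
  - exact: factV.
move=> fi.
have gi0 : pint p g0.
  have -> : g0 = fcoef r A B K + (-1)%:~R * h by rewrite fKE mulrNz; ring.
  by apply: pintD => //; apply: pintM => //; apply: pint_int.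
(* Solving the formula for [g0] writes [(2A)_{2K}] as [p] times this number. Apart from [g0], now
   supposed [p]-integral, only [v] and 2 are inverted here, and both are units at [p]. *)
apply: (poch_pndvd R A s M X' Y D (2 * K) p
  (g0 * (poch (1 + A - B) K.-1 * (v%:~R)^-1 * K`!%:R * (2 ^-1) ^+ (4 * K)))) => //.
  apply: pintM => //; do ![apply: pintM => //].
  - exact: pint_invz.
  - exact: pint_nat.
  - by apply: pint_exp => //; apply: (pint_invn _ _ 2).
have c0 : (2 ^+ (4 * K) : Cplx R) != 0 by rewrite expf_neq0 // pnatr_eq0.
rewrite g0E exprVn; move: (2 ^+ (4 * K)) c0 => c c0; field.
by rewrite c0 pC v0 pK1 fK0.
Qed.

(** * The complex exponential and its kernel *)

Lemma cos_eq1_2pi (R : realType) (x : R) :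
  cos x = 1 -> exists k : int, x = k%:~R * (2 * pi).
Proof.
move=> cx; pose k := Num.floor (x / (2 * pi)); exists k.
have pi0 := pi_gt0 R.
have /andP[k1 k2] := floor_itv (x / (2 * pi)); rewrite -/k in k1 k2.
rewrite ler_pdivlMr ?mulr_gt0 // in k1.
rewrite ltr_pdivrMr ?mulr_gt0 // rmorphD /= in k2.
have cosk (n : int) (y : R) : cos (y - n%:~R * (2 * pi)) = cos y.
  have cosn (m : nat) z : cos (z + m%:R * (2 * pi)) = cos z :> R.
    elim: m => [|m IH]; first by rewrite mul0r addr0.
    by rewrite -natr1 mulrDl mul1r addrA [X in _ + X]mulr_natl cosD2pi IH.
  case: n => m; first by rewrite -pmulrn -[LHS](cosn m) subrK.
  by rewrite NegzE mulrNz mulNr opprK -pmulrn cosn.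
pose y := x - k%:~R * (2 * pi).
have yc : cos y = 1 by rewrite /y cosk.
have y0 : 0 <= y by rewrite /y subr_ge0.
have [y1|y1] := eqVneq y 0; first by apply/eqP; rewrite -subr_eq0 -/y y1.
(* For [0 < y < 2 pi] the sine of [y / 2] is positive, which contradicts
   [1 = cos y = 1 - 2 sin^2 (y / 2)]. *)
have s0 : 0 < sin (y / 2).
  apply: sin_gt0_pi; rewrite divr_gt0 //=; last by rewrite lt_neqAle eq_sym y1.
  by rewrite ltr_pdivrMr // /y; lra.
have : sin (y / 2) ^+ 2 = 0.
  have y2 : y / 2 *+ 2 = y by rewrite mulr2n; lra.
  have := cos_mulr2n (y / 2); rewrite y2 yc cos2sin2 mulr2n; lra.
by move/eqP; rewrite sqrf_eq0 gt_eqF.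
Qed.

Lemma cexpD (R : realType) (x y : Cplx R) : cexp (x + y) = cexp x * cexp y.
Proof.
case: x y => [a b] [c d]; apply/eqP; rewrite eq_complex /cexp /reC /imC /=.
by rewrite expRD cosD sinD; apply/andP; split; apply/eqP; ring.
Qed.

Lemma e2piD (R : realType) (x y : Cplx R) : e2pi (x + y) = e2pi x * e2pi y.
Proof. by rewrite /e2pi mulrDr cexpD. Qed.

Lemma e2pi0 (R : realType) : e2pi (0 : Cplx R) = 1.
Proof.
by apply/eqP; rewrite /e2pi mulr0 eq_complex /cexp /reC /imC /= expR0 cos0 sin0 mulr0 mulr1 !eqxx.
Qed.

Lemma e2pi_neq0 (R : realType) (x : Cplx R) : e2pi x != 0.
Proof.
apply/eqP => x0; have := e2piD R x (- x); rewrite subrr e2pi0 x0 mul0r.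
by move/eqP; rewrite oner_eq0.
Qed.

Lemma e2piMn (R : realType) (n : nat) (x : Cplx R) : e2pi (n%:R * x) = e2pi x ^+ n.
Proof.
elim: n => [|n IH]; first by rewrite mul0r e2pi0.
by rewrite -natr1 mulrDl mul1r e2piD IH exprSr.
Qed.

Lemma e2pi1 (R : realType) : e2pi (1 : Cplx R) = 1.
Proof.
apply/eqP; rewrite /e2pi mulr1 eq_complex /cexp /reC /imC /=.
by rewrite expR0 mulr_natl cos2pi sin2pi mulr0 mulr1 !eqxx.
Qed.

(** The imaginary part makes the sine vanish, positivity of [expR] selects cosine 1 rather than -1,
    and the modulus then forces [z] to be real. *)
Lemma e2pi_eq1 (R : realType) (z : Cplx R) :
  e2pi z = 1 -> exists k : int, z = k%:~R.
Proof.
case: z => a b /eqP; rewrite /e2pi eq_complex /cexp /reC /imC /=.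
rewrite !mul0r !add0r => /andP[/eqP h1 /eqP h2].
have e0 := expR_gt0 (- (2 * pi * b)).
have s0 : sin (2 * pi * a) = 0.
  by move/eqP: h2; rewrite mulf_eq0 gt_eqF //= => /eqP.
have c0 : 0 < cos (2 * pi * a) by rewrite -(pmulr_rgt0 _ e0) h1.
have c1 : cos (2 * pi * a) = 1 by have := sin0cos1 s0; rewrite gtr0_norm.
have pi0 := pi_gt0 R.
have b0 : b = 0.
  move: h1; rewrite c1 mulr1 => h1.
  have := @expR_inj R _ _ (etrans h1 (esym (expR0 R))).
  by move/eqP; rewrite oppr_eq0 !mulf_eq0 pnatr_eq0 /= gt_eqF //= => /eqP.
have [k ka] := cos_eq1_2pi R _ c1; exists k.
have -> : a = k%:~R by apply: (@mulfI R (2 * pi)); rewrite ?mulf_neq0 ?gt_eqF // ka mulrC.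
by rewrite b0 -(rmorph_int (real_complex R)).
Qed.

(** * Leading terms of [q]-expansions *)

Lemma q_surj_real (R : realType) (d : R) :
  0 < d < 1 -> exists2 tau : Cplx R, upper tau & q tau = ofR d.
Proof.
move=> /andP[d0 d1]; have pi0 := pi_gt0 R.
(* On the imaginary axis [q] is [exp(-2 pi y)], and this height solves [exp(-2 pi y) = d]. *)
exists (Complex 0 (- ln d / (2 * pi))).
  by rewrite /upper /= /imC /= divr_gt0 ?mulr_gt0 // oppr_gt0 ln_lt0 // d0.
rewrite /q /qpow /e2pi mul1r.
have -> : twopii R * Complex 0 (- ln d / (2 * pi)) = Complex (ln d) 0.
  apply/eqP; rewrite eq_complex /= !mul0r mulr0 !add0r eqxx andbT; apply/eqP.
  by move: (pi : R) pi0 => x x0; field; exact: lt0r_neq0.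
by rewrite /cexp /reC /imC /= lnK ?posrE // cos0 sin0 mulr1 mulr0.
Qed.

(** Convergence at [q = 1/2] bounds the terms there by a constant [c]. At [q = t/2] the terms are
    then at most [c t^n], so for small [t] the constant term 1 dominates the rest. *)
Lemma leading_term_neq0 (R : realType) (f : Cplx R -> Cplx R) (lam s : Cplx R) :
  lam != 0 -> has_leading_term f lam s -> exists2 tau, upper tau & f tau != 0.
Proof.
move=> lam0 [a [a0 H]].
have [t0 u0 q0] := @q_surj_real R 2^-1 ltac:(lra).
have [w [cw _]] := H t0 u0.
have /cvg_seq_bounded/pinfty_ex_gt0[C C0 aC] :
    cvgn (fun n => a n * q t0 ^+ n : Cplx R).
  by apply/cvg_ex; exists 0; apply: cvg_series_cvg_0; apply/cvg_ex; exists w.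
have [c c0 CE] : exists2 c : R, 0 < c & C = ofR c.
  case: C C0 {aC} => c d; rewrite ltcE /= => /andP[/eqP -> c0].
  by exists c.
(* Chosen so that both [t] and [2 c t] are at most 1/2. *)
pose t : R := (4 * c + 2)^-1.
have t0' : 0 < t by rewrite invr_gt0; lra.
have ct : t * (4 * c + 2) = 1 by rewrite mulVf // gt_eqF //; lra.
have t1 : t <= 1 / 2 by nra.
have tc : 2 * c * t <= 1 / 2 by nra.
have [t1' u1 q1] := @q_surj_real R (t / 2) ltac:(lra).
have [w1 [cw1 fE]] := H t1' u1.
exists t1' => //; rewrite fE !mulf_neq0 ?e2pi_neq0 //.
apply/eqP => w10; rewrite w10 in cw1.
have term_le k : `|a k * q t1' ^+ k| <= ofR (c * t ^+ k).
  have -> : a k * q t1' ^+ k = (a k * q t0 ^+ k) * ofR t ^+ k.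
    have -> : q t1' = q t0 * ofR t.
      rewrite q0 q1; apply/eqP; rewrite eq_complex /=.
      by apply/andP; split; apply/eqP; field.
    by rewrite exprMn mulrA.
  have -> : ofR (c * t ^+ k) = C * ofR t ^+ k.
    by rewrite CE -[ofR (c * _)]/((c * t ^+ k)%:C)%C rmorphM rmorphXn.
  have tn : `|ofR t| = ofR t by apply: ger0_norm; rewrite lecE /= eqxx ltW.
  rewrite normrM normrX tn ler_wpM2r ?exprn_ge0 //; last exact: aC.
  by rewrite -tn.
pose S N := series (fun n => a n * q t1' ^+ n) N.
(* This is the geometric sum [c t (1 - t^N) / (1 - t)] with [1 / (1 - t) <= 2]; keeping [1 - t^N]
   lets the induction close. [S N.+1] is the first partial sum involving index [N], so the constant
   term is always present. *)
have S_le N : `|S N.+1 - 1| <= ofR (2 * c * t * (1 - t ^+ N)).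
  elim: N => [|N IH].
    by rewrite /S /series /= big_nat1 expr0 mulr1 a0 !subrr mulr0 normr0.
  have -> : S N.+2 - 1 = (S N.+1 - 1) + a N.+1 * q t1' ^+ N.+1.
    by rewrite /S /series /= big_nat_recr //= addrAC.
  apply: le_trans (ler_normD _ _) _.
  apply: le_trans (lerD IH (term_le _)) _.
  rewrite lecE /= addr0 eqxx /= exprS.
  have : 0 <= t ^+ N by rewrite exprn_ge0 // ltW.
  move: (t ^+ N) => x x0.
  suff : 0 <= c * (t * x) * (1 - 2 * t) by lra.
  by rewrite !mulr_ge0 ?(ltW c0) ?(ltW t0') //; lra.
(* If the limit were 0, some partial sum would be within 1/4 of 0 and within 1/2 of 1, giving
   [1 <= 3/4]. *)
have e4 : 0 < ofR (1 / 4) :> Cplx R by rewrite ltcE /= eqxx; lra.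
have [N _ HN] := cvgr0_norm_le _ cw1 _ e4.
have h1 := S_le N; have h2 : `|S N.+1| <= ofR (1 / 4) by apply: HN => /=.
have : (1 : Cplx R) <= ofR (3 / 4).
  rewrite -[leLHS]normr1 -[X in `|X|](subKr (S N.+1)).
  apply: le_trans (ler_normB _ _) _.
  apply: le_trans (lerD h2 h1) _; rewrite lecE /= addr0 eqxx /=.
  have : 0 <= 2 * c * t * t ^+ N by rewrite !mulr_ge0 ?exprn_ge0 ?ltW.
  by move: (t ^+ N) => x; lra.
by rewrite lecE /= eqxx /=; lra.
Qed.

(** The power series depends on [q] alone, which is invariant under [tau + 1], so only [q^s]
    changes, by [e2pi s]. Comparison at a point where [f] is nonzero gives the eigenvalue. *)
Lemma leading_term_eigenvalue (R : realType) (f : Cplx R -> Cplx R)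
    (lam s eps : Cplx R) :
  lam != 0 -> has_leading_term f lam s ->
  (forall tau, upper tau -> f (tau + 1) = eps * f tau) -> e2pi s = eps.
Proof.
move=> lam0 hf fT; have [tau ut ft] := leading_term_neq0 R f lam s lam0 hf.
have [a [a0 H]] := hf.
have ut1 : upper (tau + 1) by move: ut; rewrite /upper /= /imC; case: (tau) => x y /=; rewrite addr0.
have qT : q (tau + 1) = q tau by rewrite /q /qpow !mul1r e2piD e2pi1 mulr1.
have [w [cw fw]] := H tau ut; have [w1 [cw1 fw1]] := H _ ut1.
rewrite qT in cw1.
have ww : w1 = w := norm_cvg_unique cw1 cw.
apply: (mulIf ft); rewrite -fT // fw1 ww fw /qpow mulrDr mulr1 e2piD; ring.
Qed.

Lemma leading_term_rational (R : realType) (f : Cplx R -> Cplx R)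
    (lam s eps : Cplx R) (n : nat) :
  lam != 0 -> has_leading_term f lam s ->
  (forall tau, upper tau -> f (tau + 1) = eps * f tau) ->
  (0 < n)%N -> eps ^+ n = 1 -> is_rational s.
Proof.
move=> lam0 hf fT n0; rewrite -(leading_term_eigenvalue R f lam s eps) // -e2piMn.
case/e2pi_eq1 => k kE; exists (k%:~R / n%:R).
rewrite fmorph_div rmorph_int rmorph_nat -kE mulrC mulKf //.
by rewrite pnatr_eq0 -lt0n.
Qed.

(** * Translation by [T] and rationality of the exponents *)

Lemma vvmf_translation (R : realType) (rho : 'M[int]_2 -> 'M[Cplx R]_2) (k : int)
    (F : Cplx R -> 'cV[Cplx R]_2) (tau : Cplx R) :
  is_vvmf k rho F -> upper tau -> F (tau + 1) = rho Tmx *m F tau.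
Proof.
move=> [_ FT _] ut; rewrite -FT //.
  rewrite /slash /moebius /autj !mxE /= mul0r add0r mul1r divr1.
  by rewrite exp1rz scale1r.
split; last by rewrite mxE.
rewrite /SL2Z /= (expand_det_row _ 1) big_ord_recl big_ord1 /cofactor.
by rewrite !det_mx11 !mxE /= mul0r.
Qed.

Lemma diag2_expn (R : realType) (x y : Cplx R) (n : nat) :
  diag2 x y ^+ n = diag2 (x ^+ n) (y ^+ n).
Proof.
elim: n => [|n IH].
  by apply/matrixP => i j; rewrite !mxE /=; case: eqP => //=; case: eqP.
rewrite exprS IH; apply/matrixP => i j; rewrite !mxE big_ord_recl big_ord1 !mxE.
by case: i => -[|[|//]] ?; case: j => -[|[|//]] ? /=;
  rewrite -?val_eqE /= ?mulr0 ?mul0r ?addr0 ?add0r ?exprS.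
Qed.

(** The first component of [X F] is an eigenfunction of translation with eigenvalue [x], and the
    finite order of [rho Tmx] makes [x] a root of unity. *)
Lemma exponent_rational (R : realType) (rho : 'M[int]_2 -> 'M[Cplx R]_2)
    (k : int) (F : Cplx R -> 'cV[Cplx R]_2) (X : 'M[Cplx R]_2)
    (x y lam s : Cplx R) :
  is_vvmf k rho F -> finite_order (rho Tmx) -> X \in unitmx ->
  X *m rho Tmx *m invmx X = diag2 x y -> lam != 0 ->
  has_leading_term (coord_fun (fun tau => X *m F tau) 0) lam s ->
  is_rational s.
Proof.
move=> HF [n [n0 Tn]] HX HXT lam0 hl.
have XT : X *m rho Tmx = diag2 x y *m X by rewrite -HXT mulmxKV.
apply: (leading_term_rational R _ lam s x n lam0 hl) => //.
  move=> tau ut; rewrite /coord_fun (vvmf_translation R rho k F) // mulmxA XT -mulmxA.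
  by rewrite [LHS]mxE big_ord_recl big_ord1 !mxE /= mul0r addr0.
have XTn m : X *m (rho Tmx ^+ m) = diag2 x y ^+ m *m X.
  elim: m => [|m IH]; first by rewrite !expr0 mulmx1 mul1mx.
  by rewrite exprS mulmxA XT -mulmxA IH mulmxA [in RHS]exprS.
have : diag2 x y ^+ n = 1.
  by rewrite -[LHS](mulmxK HX) -XTn Tn mulmx1 mulmxV.
by rewrite diag2_expn => /matrixP/(_ 0 0); rewrite !mxE.
Qed.

(** * Arithmetic in the quadratic field [Q(r)] *)

Lemma Qadj_rational (R : realType) (x z : Cplx R) :
  is_rational x -> Qadj x z -> is_rational z.
Proof.
move=> [s ->] [f [g [_ ->]]]; exists (f.[s] / g.[s]).
by rewrite !horner_map fmorph_div.
Qed.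

Lemma Qadj_self (R : realType) (x : Cplx R) : Qadj x x.
Proof.
exists 'X, 1; rewrite rmorph1 map_polyX !hornerE oner_neq0; split=> //.
by rewrite divr1.
Qed.

(** All of [Q(x)] is rational here, so two basis elements satisfy a nontrivial rational relation,
    against uniqueness of the coordinates of 0. *)
Lemma rational_Qdegree (R : realType) (x : Cplx R) :
  is_rational x -> ~ Qdegree x 2.
Proof.
move=> xQ [b [bQ bbasis]].
have b0Q := Qadj_rational R _ _ xQ (bQ 0); have b1Q := Qadj_rational R _ _ xQ (bQ 1).
case: b0Q b1Q => b0 b0E [b1 b1E].
have Q0 : Qadj x 0.
  by exists 0, 1; rewrite rmorph0 rmorph1 !hornerE oner_neq0 ?mul0r.
have [s [_ suniq]] := bbasis 0 Q0.
pose v c d : {ffun 'I_2 -> rat} := [ffun i => if i == 0 then c else d].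
have uniq c d : c * b0 + d * b1 = 0 -> c = 0 /\ d = 0.
  move=> cd.
  have vE c' d' : c' * b0 + d' * b1 = 0 -> s = v c' d'.
    move=> e; apply: suniq; rewrite big_ord_recl big_ord1.
    have -> : lift ord0 ord0 = 1 :> 'I_2 by apply/val_inj.
    by rewrite b0E b1E !ffunE /= -!rmorphM -rmorphD e rmorph0.
  have := vE c d cd; rewrite (vE 0 0) ?mul0r ?addr0 // => /ffunP e.
  by have := e 0; have := e 1; rewrite !ffunE.
(* The relation [b1 * b0 - b0 * b1 = 0] makes both basis elements vanish; then the coordinates
   [(1, 1)] also represent 0. *)
have [b10 b00] : b1 = 0 /\ - b0 = 0 by apply: uniq; ring.
have [/eqP] : (1 : rat) = 0 /\ (1 : rat) = 0.
  by apply: uniq; rewrite b10 -[b0]opprK b00; ring.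
by rewrite oner_eq0.
Qed.

Lemma horner_quadratic (R : realType) (s : Cplx R) (M : int) (f : {poly rat}) :
  s ^+ 2 = M%:~R ->
  exists x y : rat, (map_poly ratr f).[s] = ratr x + ratr y * s.
Proof.
move=> sM; elim/poly_ind: f => [|f c [x [y IH]]].
  by exists 0, 0; rewrite !rmorph0 horner0 mul0r addr0.
exists (y * M%:~R + c), x.
rewrite rmorphD rmorphM /= map_polyX map_polyC /= !hornerE IH.
by rewrite rmorphD rmorphM /= rmorph_int -sM; ring.
Qed.

(** The denominator is rationalised by its conjugate [c - d s], which is nonzero because [s] is
    irrational. *)
Lemma Qadj_sqrt (R : realType) (s z : Cplx R) (M : int) :
  s ^+ 2 = M%:~R -> ~ is_rational s -> Qadj s z ->
  exists x y : rat, z = ratr x + ratr y * s.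
Proof.
move=> sM sQ [f [g [g0 ->]]].
have [a [b ->]] := horner_quadratic R s M f sM.
have [c [d gE]] := horner_quadratic R s M g sM.
rewrite gE in g0 *.
have conj0 : ratr c - ratr d * s != 0.
  have [d0|d0] := eqVneq d 0.
    by move: g0; rewrite d0 rmorph0 mul0r subr0 addr0.
  apply/eqP => /eqP; rewrite subr_eq0 => /eqP cd; apply: sQ; exists (c / d).
  by rewrite fmorph_div /= cd mulrC mulKf // fmorph_eq0.
pose N := c ^+ 2 - M%:~R * d ^+ 2.
have NE : ratr N = (ratr c + ratr d * s) * (ratr c - ratr d * s).
  by rewrite /N rmorphB rmorphM !rmorphXn /= rmorph_int -sM; ring.
exists ((a * c - b * d * M%:~R) / N), ((b * c - a * d) / N).
rewrite !fmorph_div /= NE !rmorphB !rmorphM /= rmorph_int -sM; field.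
by rewrite conj0 g0.
Qed.

(** Meant for the two coordinates of [r] and the rational number [l1]: one [D] then serves both [r]
    and [A]. *)
Lemma ratr_common_denom (R : realType) (x y z : rat) :
  exists (D : nat) (X Y Z : int),
    [/\ (0 < D)%N, D%:R * ratr x = X%:~R :> Cplx R,
        D%:R * ratr y = Y%:~R :> Cplx R & D%:R * ratr z = Z%:~R :> Cplx R].
Proof.
exists (absz (denq x * denq y * denq z)), (numq x * (denq y * denq z)),
  (numq y * (denq x * denq z)), (numq z * (denq x * denq y)).
have d0 w : (denq w)%:~R != 0 :> Cplx R by rewrite intr_eq0 denq_neq0.
have rE w : ratr w = (numq w)%:~R / (denq w)%:~R :> Cplx R by [].
rewrite absz_gt0 !mulf_neq0 ?denq_neq0 // pmulrn gez0_abs; last first.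
  by rewrite !mulr_ge0 // denq_ge0.
by rewrite !rE; split=> //; rewrite !rmorphM /=; field; rewrite ?d0.
Qed.

(** * Coordinates of [r] and [A] in [Q(sqrt M)], and the choice of [K0] *)

Theorem theorem5p21 (R : realType)
  (rho : 'M[int]_2 -> 'M[Cplx R]_2)
  (Hrep : is_representation rho) (Hirr : irreducible_rep rho)
  (k0 : int) (Hk0 : is_minimal_weight rho k0)
  (F : Cplx R -> 'cV[Cplx R]_2)
  (HF : is_vvmf k0 rho F) (HF0 : ~ is_zero_form F)
  (a b c : Cplx R) (Hmlde : satisfies_mlde k0 a b c F)
  (r : Cplx R) (Hr : r ^+ 2 - (a + 1 / 3) * r + b + 4 * c = 0)
  (HT : finite_order (rho Tmx)) (Hc : is_rational c) (Hr2 : Qdegree r 2)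
  (X : 'M[Cplx R]_2) (HX : X \in unitmx)
  (m1 m2 : Cplx R) (Hm : `|m1| <= `|m2|)
  (HXT : X *m rho Tmx *m invmx X = diag2 (e2pi m1) (e2pi m2))
  (lam1 lam2 l1 l2 : Cplx R) (Hlam1 : lam1 != 0) (Hlam2 : lam2 != 0)
  (Hl1 : has_leading_term (coord_fun (fun tau => X *m F tau) 0)
           lam1 (k0%:~R / 12 + l1))
  (Hl2 : has_leading_term (coord_fun (fun tau => X *m F tau) 1)
           lam2 (k0%:~R / 12 + l2))
  (A B : Cplx R) (HA : A = r + l1) (HB : B = r + l2)
  (u v : int) (Huv : A - B = u%:~R / v%:~R) (Hv : 1 < v) (Hcop : coprimez u v)
  (M : int) (HM : squarefree M) (HMr : Qadj r = Qadj (sqrtC M%:~R))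
  (HS : infinite_set (primeS M u v)) :
  exists K0 : nat, forall K p : nat,
    (K0 <= K)%N -> p%:Z = u + K%:Z * v -> primeS M u v p ->
    ~ p_integral p (fcoef r A B K) /\ p_integral p (p%:R * fcoef r A B K).
Proof.
pose s : Cplx R := sqrtC M%:~R.
have sM : s ^+ 2 = M%:~R by rewrite sqrtCK.
have rQ : ~ is_rational r by move=> /rational_Qdegree; apply.
have sQ : ~ is_rational s.
  move=> sQ; apply: rQ; apply: (Qadj_rational R s) => //.
  by rewrite -HMr; apply: Qadj_self.
have [x [y rE]] : exists x y : rat, r = ratr x + ratr y * s.
  by apply: (Qadj_sqrt R s r M) => //; rewrite -HMr; apply: Qadj_self.
have y0 : y != 0.
  by apply/eqP => y0; apply: rQ; exists x; rewrite rE y0 rmorph0 mul0r addr0.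
(* Here [e] is the whole exponent [k0/12 + l1]; removing [k0/12] shows that [l1] is rational. *)
have [e eE] := exponent_rational R rho k0 F X _ _ lam1 _ HF HT HX HXT Hlam1 Hl1.
pose l := e - k0%:~R / 12%:R.
have lE : l1 = ratr l.
  by rewrite /l rmorphB fmorph_div rmorph_int rmorph_nat /= -eE; ring.
have [D [X0 [Y [L [D0 DX DY DL]]]]] := ratr_common_denom R x y l.
have DrE : D%:R * r = X0%:~R + Y%:~R * s by rewrite rE -DX -DY; ring.
have DAE : D%:R * A = (X0 + L)%:~R + Y%:~R * s.
  by rewrite HA mulrDr DrE lE DL rmorphD /=; ring.
have Y0 : Y != 0.
  rewrite -(intr_eq0 (Cplx R)) -DY mulf_neq0 ?fmorph_eq0 //.
  by rewrite pnatr_eq0 -lt0n.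
(* As [v >= 2] and [K > |u|], one gets [p = u + K v > K]. Hence [p] exceeds [D] and [|Y|], which are
   nonzero, and divides neither. *)
exists (`|u| + D + `|Y|).+1%N => K p KK0 pE [pp podd nr _].
have Kp : (K < p)%N by nia.
have pv : ~~ (p%:Z %| v)%Z.
  apply/negP => pv; have pu : (p%:Z %| u)%Z.
    have -> : u = p%:Z - K%:Z * v by rewrite pE addrK.
    by rewrite rpredB ?dvdzz // dvdz_mull.
  have : (p%:Z %| gcdz u v)%Z by rewrite dvdz_gcd pu.
  by move/eqP: Hcop => ->; rewrite dvdzE dvdn1; case: (p) pp => [|[]].
have [h1 h2] : ~ pint p (fcoef r A B K) /\ pint p (p%:R * fcoef r A B K).
  apply: (fcoef_pole R r A B s M X0 (X0 + L) Y u v D) => //.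
  - by rewrite gtnNdvd //; lia.
  - by rewrite dvdzE gtnNdvd ?absz_gt0 //=; lia.
  - by rewrite Kp andbT; lia.
by split; [move/p_integralP | apply/p_integralP].
Qed.
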